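(* Let $V$ be a real reflexive Banach space with norm $\|\cdot\|$, dual $V^*$ and duality brackets $\langle\cdot,\cdot\rangle$, and let $X$ be a real Hilbert space with norm $\|\cdot\|_X$. Let $A\colon V\to V^*$, $j\colon X\times X\to\mathbb{R}$, $M\colon V\to X$, $U\colon V\to 2^V$, $\phi,\phi_n\colon V\to\mathbb{R}$ and $f,f_n\in V^*$ ($n\in\mathbb{N}$) satisfy the following. (A) $A$ is pseudomonotone, and there is $m_A>0$ with $\langle Av_1-Av_2,v_1-v_2\rangle\ge m_A\|v_1-v_2\|^2$ for all $v_1,v_2\in V$. (j) (i) $j(w,\cdot)$ is locally Lipschitz for all $w\in X$; (ii) there are $d_1,d_2,d_3\ge 0$ such that $\|\partial j(w,v)\|_X\le d_1+d_2\|w\|_X+d_3\|v\|_X$ for all $w,v\in X$; (iii) the map $X\times X\times X\ni(w,v,z)\mapsto j^0(w,v;z)\in\mathbb{R}$ is upper semicontinuous. (M) $M$ is linear, bounded and compact. (U) $U$ has nonempty, closed, convex values, $0\in U(v)$ for all $v\in V$, and $U$ is weakly Mosco continuous: if $v_n\rightharpoonup v$ weakly in $V$, then $U(v_n)$ converges to $U(v)$ in the Mosco sense. ($\phi$) (i) $\phi$ and all $\phi_n$ are convex and lower semicontinuous; (ii) $\phi(v)\ge 0$ and $\phi_n(v)\ge 0$ for all $v\in V$, and $\phi(0)=\phi_n(0)=0$; (iii) there is $c>0$ such that for all $n\in\mathbb{N}$ and all $v_1,v_2\in V$, $\phi(v_1)-\phi(v_2)\le c\|v_1-v_2\|$ and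 $\phi_n(v_1)-\phi_n(v_2)\le c\|v_1-v_2\|$; (iv) $\limsup(\phi_n(v)-\phi_n(u_n))\le\phi(v)-\phi(u)$ for all $u_n\rightharpoonup u$ weakly in $V$ and all $v\in V$. (f) $f_n\to f$ in $V^*$. Assume moreover that $(d_2+d_3)\|M\|^2<m_A$. For each $n\in\mathbb{N}$ let $u_n\in V$ be a solution of problem $P(f_n,\phi_n)$, i.e. $u_n\in U(u_n)$ and $$\langle Au_n-f_n,z-u_n\rangle+j^0(Mu_n,Mu_n;Mz-Mu_n)+\phi_n(z)-\phi_n(u_n)\ge 0\quad\text{for all } z\in U(u_n).$$ Then there is a subsequence of $\{u_n\}$ that converges (strongly) in $V$ to an element $u\in V$ which is a solution of problem $P(f,\phi)$, i.e. $u\in U(u)$ and $$\langle Au-f,z-u\rangle+j^0(Mu,Mu;Mz-Mu)+\phi(z)-\phi(u)\ge 0\quad\text{for all } z\in U(u).$$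
   Context: For a locally Lipschitz function $h\colon X\to\mathbb{R}$, the Clarke generalized directional derivative is $h^0(x;v)=\limsup_{y\to x,\ \lambda\downarrow 0}\frac{h(y+\lambda v)-h(y)}{\lambda}$ and the generalized subgradient is $\partial h(x)=\{\zeta\in X^*\mid h^0(x;v)\ge\langle\zeta,v\rangle\ \text{for all } v\in X\}$; here $X^*$ is identified with the Hilbert space $X$. For $j\colon X\times X\to\mathbb{R}$, $j^0(w,v;z)$ and $\partial j(w,v)$ denote the generalized directional derivative (in direction $z$) and the generalized subgradient of $j(w,\cdot)$ at $v$, with $w$ fixed. For a set $S$, $\|S\|_X=\sup\{\|x\|_X\mid x\in S\}$. $\|M\|$ is the operator norm. An operator $A\colon V\to V^*$ is pseudomonotone if it maps bounded sets into bounded sets and, whenever $u_n\rightharpoonup u$ in $V$ with $\limsup\langle Au_n,u_n-u\rangle\le 0$, one has $\langle Au,u-v\rangle\le\liminf\langle Au_n,u_n-v\rangle$ for all $v\in V$. A sequence $\{C_n\}$ of closed convex subsets of a normed space $Y$ converges in the Mosco sense to a closed convex set $C\subset Y$ if: $(m_1)$ whenever $z_n\in C_n$ and $z_n\rightharpoonup z$ weakly in $Y$ along a subsequence, then $z\in C$; $(m_2)$ for every $z\in C$ there exist $z_n\in C_n$ with $z_n\to z$ strongly in $Y$. *)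

(* Defs.v *)
From HB Require Import structures.
From mathcomp Require Import all_boot all_order all_algebra.
From mathcomp Require Import all_classical all_reals all_analysis.
Set Implicit Arguments. Unset Strict Implicit. Unset Printing Implicit Defensive.
Import Order.TTheory GRing.Theory Num.Theory.
Import numFieldNormedType.Exports.
Local Open Scope classical_set_scope.
Local Open Scope ring_scope.

Definition opnorm (R : realType) (V W : normedModType R) (f : V -> W) : R :=
  sup [set `|f x| | x in [set x | `|x| <= 1]].

Section opnorm_theory.
Context {R : realType} {V W : normedModType R}.

Lemma opnorm_has_sup (f : {linear V -> W}) : continuous f ->
  has_sup [set `|f x| | x in [set x | `|x| <= 1]].
Proof.
move=> cf; split; first by exists `|f 0|, 0 => //=; rewrite normr0.
have /bounded_funP/(_ 1)[M fM] := continuous_linear_bounded 0 (cf 0).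
by exists M => _ [x /= x1 <-]; exact: fM.
Qed.

Lemma opnorm_ge0 (f : V -> W) : 0 <= opnorm f.
Proof.
rewrite /opnorm; set A := [set _ | _ in _].
have A0 : A `|f 0| by exists 0 => //=; rewrite normr0.
case: (pselect (has_sup A)) => [sA|/sup_out -> //].
exact: le_trans (normr_ge0 (f 0)) (ub_le_sup (proj2 sA) A0).
Qed.

Lemma le_opnorm (f : {linear V -> W}) (x : V) :
  continuous f -> `|f x| <= opnorm f * `|x|.
Proof.
move=> cf; have [->|x0] := eqVneq x 0; first by rewrite linear0 !normr0 mulr0.
rewrite -ler_pdivrMr ?normr_gt0//.
have -> : `|f x| / `|x| = `|f (`|x|^-1 *: x)|.
  by rewrite linearZ normrZ normfV normr_id mulrC.
apply: ub_le_sup; first exact: (proj2 (opnorm_has_sup cf)).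
exists (`|x|^-1 *: x) => //=.
by rewrite normrZ normfV normr_id mulVf ?normr_eq0.
Qed.

Lemma opnorm_le (f : V -> W) (M : R) :
  (forall x, `|x| <= 1 -> `|f x| <= M) -> opnorm f <= M.
Proof.
move=> fM; apply: ge_sup; first by exists `|f 0|, 0 => //=; rewrite normr0.
by move=> _ [x /= x1 <-]; exact: fM.
Qed.

End opnorm_theory.

Section dual_space.
Context {R : realType} {V : normedModType R}.

Definition dual_pred : {pred V -> R} :=
  [pred f : V -> R | `[< linear f /\ continuous f >]].

Record dual_space := DualSpace {
  dual_fun :> V -> R ;
  _ : dual_fun \in dual_pred }.

HB.instance Definition _ := [isSub for dual_fun].
HB.instance Definition _ := [Choice of dual_space by <:].

Lemma dual_pred_submod : submod_closed dual_pred.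
Proof.
split=> [|a f g].
  rewrite inE; split=> [k x y|x].
    by rewrite /= scaler0 addr0.
  exact: cvg_cst.
rewrite !inE => -[lf cf] [lg cg]; split=> [k x y|x].
  by rewrite /= !fctE lf lg !scalerDr !scalerA mulrC addrACA.
by apply: cvgD; [apply: cvgZr; exact: cf|exact: cg].
Qed.

HB.instance Definition _ :=
  GRing.isSubmodClosed.Build R (V -> R) dual_pred dual_pred_submod.

HB.instance Definition _ := [SubChoice_isSubLmodule of dual_space by <:].

Lemma dual_linear (f : dual_space) : linear f.
Proof. by case: f => f /= /[!inE] -[]. Qed.

HB.instance Definition _ (f : dual_space) :=
  GRing.isLinear.Build R V R _ (dual_fun f) (dual_linear f).

Lemma dual_continuous (f : dual_space) : continuous f.
Proof. by case: f => f /= /[!inE] -[]. Qed.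

Let dnorm (f : dual_space) : R := opnorm f.

Let dnormD f g : dnorm (f + g) <= dnorm f + dnorm g.
Proof.
apply: opnorm_le => x x1.
have bnd (h : dual_space) : `|h x| <= dnorm h.
  apply: le_trans (le_opnorm x (@dual_continuous h)) _.
  by rewrite ler_piMr// opnorm_ge0.
by apply: le_trans (ler_normD _ _) _; exact: lerD.
Qed.

Let dnorm_scale (l : R) f : dnorm (l *: f) <= `|l| * dnorm f.
Proof.
apply: opnorm_le => x x1; rewrite normrM ler_wpM2l//.
apply: le_trans (le_opnorm x (@dual_continuous f)) _.
by rewrite ler_piMr// opnorm_ge0.
Qed.

Let dnormZ (l : R) f : dnorm (l *: f) = `|l| * dnorm f.
Proof.
apply/eqP; rewrite eq_le dnorm_scale/=.
have [->|l0] := eqVneq l 0; first by rewrite normr0 mul0r opnorm_ge0.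
rewrite -ler_pdivlMl ?normr_gt0// -normfV.
by apply: le_trans (dnorm_scale _ _); rewrite scalerA mulVf// scale1r.
Qed.

Let dnorm0_eq0 f : dnorm f = 0 -> f = 0.
Proof.
move=> f0; apply: val_inj; apply/funext => x /=.
have := le_opnorm x (@dual_continuous f).
by rewrite [opnorm _]f0 mul0r normr_le0 => /eqP.
Qed.

HB.instance Definition _ :=
  Lmodule_isNormed.Build R dual_space dnormD dnormZ dnorm0_eq0.

Lemma dual_normE (f : dual_space) : `|f| = opnorm f.
Proof. by []. Qed.

End dual_space.
Arguments dual_space {R} V.

(* The canonical map V -> V^** is onto. *)
Definition reflexive_space (R : realType) (V : normedModType R) :=
  forall F : dual_space (dual_space V),
    exists v : V, forall f : dual_space V, F f = f v.

HB.mixin Record isHilbert (R : realType) X & CompleteNormedModule R X := {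
  inner : {dot X for idfun} ;
  innerE : forall x : X, inner x x = `|x| ^+ 2 }.

#[short(type="hilbertType")]
HB.structure Definition Hilbert (R : realType) :=
  { X of CompleteNormedModule R X & isHilbert R X }.

Definition weakly_cvg (R : realType) (V : normedModType R)
    (v_ : nat -> V) (v : V) :=
  forall f : dual_space V, f (v_ n) @[n --> \oo] --> f v.

(* Sequences are indexed by all of nat; only a subsequence of z_ has to converge
   in the first condition. *)
Definition mosco_cvg (R : realType) (Y : normedModType R)
    (C_ : nat -> set Y) (C : set Y) :=
  (forall (z_ : nat -> Y) (z : Y), (forall n, C_ n (z_ n)) ->
    (exists2 e : nat -> nat, increasing_seq e & weakly_cvg (z_ \o e) z) ->
    C z) /\
  (forall z, C z ->
    exists2 z_ : nat -> Y, forall n, C_ n (z_ n) & z_ @ \oo --> z).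

Definition weakly_mosco_continuous (R : realType) (V : normedModType R)
    (U : V -> set V) :=
  forall (v_ : nat -> V) (v : V),
    weakly_cvg v_ v -> mosco_cvg (fun n => U (v_ n)) (U v).

Definition pseudomonotone (R : realType) (V : normedModType R)
    (A : V -> dual_space V) :=
  (forall B : set V, bounded_set B -> bounded_set (A @` B)) /\
  (forall (u_ : nat -> V) (u : V), weakly_cvg u_ u ->
    (limn_esup (fun n => (A (u_ n) (u_ n - u))%:E) <= 0)%E ->
    forall v, ((A u (u - v))%:E <=
      limn_einf (fun n => (A (u_ n) (u_ n - v))%:E))%E).

Definition locally_lipschitz (R : realType) (X : normedModType R)
    (h : X -> R) :=
  forall x : X, exists2 A, nbhs x A & [lipschitz h y | y in A].

(* limsup as (y, lambda) -> (x, 0^+) jointly. The value is kept in \bar R; it is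
   finite whenever h is locally Lipschitz. *)
Definition clarke_deriv (R : realType) (X : normedModType R)
    (h : X -> R) (x v : X) : \bar R :=
  limf_esup (fun p : X * R => ((h (p.1 + p.2 *: v) - h p.1) / p.2)%:E)
    (filter_prod (nbhs x) (0 : R)^'+).

(* X^* is identified with X through the inner product. *)
Definition clarke_subgrad (R : realType) (X : hilbertType R)
    (h : X -> R) (x : X) : set X :=
  [set zeta | forall v, ((inner zeta v)%:E <= clarke_deriv h x v)%E].

Definition set_norm (R : realType) (X : normedModType R) (S : set X) : \bar R :=
  ereal_sup [set (`|x|)%:E | x in S].

Definition upper_semicontinuous (R : realType) (T : topologicalType)
    (g : T -> \bar R) :=
  forall x (a : R), (g x < a%:E)%E ->
    exists2 N, nbhs x N & forall y, N y -> (g y < a%:E)%E.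

Definition compact_operator (R : realType) (V W : normedModType R)
    (f : V -> W) :=
  forall B : set V, bounded_set B -> precompact (f @` B).


Definition is_solution (R : realType) (V : normedModType R) (X : hilbertType R)
    (A : V -> dual_space V) (j : X -> X -> R) (M : V -> X) (U : V -> set V)
    (f : dual_space V) (phi : V -> R) (u : V) :=
  U u u /\
  forall z, U u z ->
    (0 <= ((A u - f) (z - u))%:E + clarke_deriv (j (M u)) (M u) (M z - M u)%R
          + (phi z - phi u)%:E)%E.

(* Main.v *)
Require Import Defs.
From HB Require Import structures.
From mathcomp Require Import all_boot all_order all_algebra.
From mathcomp Require Import all_classical all_reals all_analysis.
From mathcomp Require Import ring lra.
Set Implicit Arguments. Unset Strict Implicit. Unset Printing Implicit Defensive.
Import Order.TTheory GRing.Theory Num.Theory.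
Import numFieldNormedType.Exports.
Local Open Scope classical_set_scope.
Local Open Scope ring_scope.

(* The inequality P(f_n, phi_n) tested at 0 bounds u_n, because the Clarke
   derivative grows at most like the subgradient and (d2 + d3) |M|^2 < mA. Along
   a weakly convergent subsequence the Mosco limit u lies in U(u), so u is the
   strong limit of some w_k in U(u_k); testing at w_k, strong monotonicity and
   the compactness of M force u_k to converge strongly to u. A last recovery
   sequence, pseudomonotonicity and the upper semicontinuity of the Clarke
   derivative give the limit inequality. *)

(** * Hahn-Banach theorem *)

(** The growth condition bounds subgradients, whereas the inequalities contain Clarke derivatives.
    The passage needs, for each direction, a subgradient that attains the derivative there; this is
    why a Hahn-Banach theorem with a prescribed point of contact and Riesz representation come
    first. For the subsequence, reflexivity yields weak limits along ultrafilters, but [V] is not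
    assumed separable, so countably many test functionals have to be built from the sequence itself.
    In the limit passage the constraint sets move: a fixed [u] or [z] need not lie in [U (u_k)], so
    every test element depends on k. Replacing it by its limit afterwards costs only vanishing
    terms, thanks to the common Lipschitz constant [c] and the boundedness of [A] on bounded sets.
    The differences of [phi_n] are controlled only from above in the limit, so they are kept apart
    from the error terms that tend to 0. *)

Lemma le_infD (R : realType) (S T : set R) (c : R) : S !=set0 -> T !=set0 ->
  (forall a b, S a -> T b -> c <= a + b) -> c <= inf S + inf T.
Proof.
move=> S0 T0 cST; rewrite -lerBlDr; apply: lb_le_inf => // a Sa.
by rewrite lerBlDr -lerBlDl; apply: lb_le_inf => // b Tb; rewrite lerBlDl cST.
Qed.

Section hahn_banach.
Context {R : realType} {V : lmodType R}.
Implicit Types (p q h : V -> R) (x y : V) (t : R).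

Definition sublinear p := (forall x y, p (x + y) <= p x + p y) /\
  (forall t x, 0 <= t -> p (t *: x) <= t * p x).

Lemma sublinear0 p : sublinear p -> p 0 = 0.
Proof.
move=> [pD pZ]; apply/eqP; rewrite eq_le; apply/andP; split.
  by have := pZ 0 0 (lexx _); rewrite scale0r mul0r.
by have := pD 0 0; rewrite addr0 -subr_ge0 addrK.
Qed.

Lemma sublinearZ p t x : sublinear p -> 0 <= t -> p (t *: x) = t * p x.
Proof.
move=> sp; rewrite le_eqVlt => /predU1P[<-|t0].
  by rewrite scale0r mul0r sublinear0.
apply/eqP; rewrite eq_le (sp.2 _ _ (ltW t0))/= -ler_pdivlMl//.
by rewrite -{1}(scalerK (lt0r_neq0 t0) x); apply: sp.2; rewrite invr_ge0 ltW.
Qed.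

Lemma sublinear_geN p x : sublinear p -> - p (- x) <= p x.
Proof.
move=> sp; rewrite lerNl -subr_ge0 opprK addrC -(sublinear0 sp) -(subrr x).
exact: sp.1.
Qed.

(* The largest sublinear functional below p whose value at - y is at most
   - p y. *)
Definition sublinear_tilt p y x :=
  inf [set p (x + t *: y) - t * p y | t in [set t | 0 <= t]].

Section tilt.
Variables (p : V -> R) (y : V).
Hypothesis sp : sublinear p.

Let tilt_lb x :
  has_lbound [set p (x + t *: y) - t * p y | t in [set t | 0 <= t]].
Proof.
(* The bound comes from t p(y) = p((x + t y) - x) <= p(x + t y) + p(-x). *)
exists (- p (- x)) => _ [t /= t0 <-].
rewrite lerBrDr addrC lerBlDr -sublinearZ//.
rewrite -{1}(addKr x (t *: y)) addrC.
by rewrite [X in X <= _](_ : _ = p (x + t *: y - x)) ?sp.1// addrC.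
Qed.

Lemma sublinear_tilt_le x t : 0 <= t ->
  sublinear_tilt p y x <= p (x + t *: y) - t * p y.
Proof. by move=> t0; apply: ge_inf => //; exists t. Qed.

Lemma sublinear_tilt_le_self x : sublinear_tilt p y x <= p x.
Proof.
by have := @sublinear_tilt_le x 0 (lexx 0); rewrite scale0r addr0 mul0r subr0.
Qed.

Lemma sublinear_tiltN : sublinear_tilt p y (- y) <= - p y.
Proof.
have := @sublinear_tilt_le (- y) 1 ler01.
by rewrite scale1r addNr sublinear0// mul1r sub0r.
Qed.

Let tilt_neq0 x :
  [set p (x + t *: y) - t * p y | t in [set t | 0 <= t]] !=set0.
Proof. by exists (p (x + 0 *: y) - 0 * p y), 0 => /=. Qed.

Lemma sublinear_tiltP : sublinear (sublinear_tilt p y).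
Proof.
split=> [x x'|s x].
  apply: le_infD => // _ _ [t /= t0 <-] [t' /= t'0 <-].
  apply: le_trans (sublinear_tilt_le _ (addr_ge0 t0 t'0)) _.
  rewrite scalerDl addrACA mulrDl opprD [leRHS]addrACA lerD2r.
  exact: sp.1.
rewrite le_eqVlt => /predU1P[<-|s0].
  by rewrite scale0r mul0r -(sublinear0 sp) sublinear_tilt_le_self.
rewrite -ler_pdivrMl//; apply: lb_le_inf => // _ [t /= t0 <-].
rewrite ler_pdivrMl// mulrBr -(sublinearZ _ sp (ltW s0)) scalerDr scalerA mulrA.
by apply: (sublinear_tilt_le (s *: x)); rewrite mulr_ge0// ltW.
Qed.

End tilt.

(** The tilt of [q] along [y] is sublinear and below [q], hence equal to [q]. Its defining bound at
    t = 1 then reads q(x) <= q(x + y) - q(y), the converse of subadditivity. *)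
Lemma minimal_sublinear_linear q : sublinear q ->
  (forall r, sublinear r -> (forall x, r x <= q x) -> r = q) -> linear q.
Proof.
move=> sq qmin; have qD x y : q (x + y) = q x + q y.
  apply/eqP; rewrite eq_le sq.1/= -lerBrDr.
  have <- := qmin _ (sublinear_tiltP y sq) (sublinear_tilt_le_self y sq).
  have := @sublinear_tilt_le _ y sq x 1 ler01; rewrite scale1r mul1r.
  by rewrite (qmin _ (sublinear_tiltP y sq) (sublinear_tilt_le_self y sq)).
have qN x : q (- x) = - q x.
  by apply/eqP; rewrite -addr_eq0 -qD addNr sublinear0.
move=> t x y; rewrite qD; congr (_ + _).
have [t0|t0] := leP 0 t; first exact: sublinearZ.
have Nt0 : 0 <= - t by rewrite oppr_ge0 ltW.
by rewrite -[t]opprK scaleNr qN sublinearZ// [RHS]mulNr.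
Qed.

(** Zorn's lemma for the reversed pointwise order: a nonempty chain is bounded by its pointwise
    infimum, which is finite because every q below p satisfies q(x) >= -q(-x) >= -p(-x). *)
Lemma minimal_sublinear_exists p : sublinear p ->
  exists q, [/\ sublinear q, forall x, q x <= p x &
    forall r, sublinear r -> (forall x, r x <= q x) -> r = q].
Proof.
move=> sp.
pose T := {q : V -> R | sublinear q /\ forall x, q x <= p x}.
pose ge (F G : T) := forall x : V, sval G x <= sval F x.
have [|||A Atot|[q [sq qp]] qmin] := @Zorn T (fun F G => `[< ge F G >]).
- by move=> q; apply/asboolP => x.
- move=> q r s /asboolP qr /asboolP rs; apply/asboolP => x.
  exact: le_trans (rs x) (qr x).
- move=> [q Hq] [r Hr] /asboolP qr /asboolP rq.
  apply: eq_exist; apply/funext => x.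
  by apply/eqP; rewrite eq_le; apply/andP; split; [exact: rq|exact: qr].
- have [[q0 Aq0]|A0] := pselect (A !=set0); last first.
    exists (exist _ p (conj sp (fun x => lexx _))) => s As.
    by exfalso; apply: A0; exists s.
  pose S x := [set sval q x | q in A].
  have S0 x : S x !=set0 by exists (sval q0 x), q0.
  have lbS x : has_lbound (S x).
    exists (- p (- x)) => _ [[q [sq qp]] Aq <-] /=.
    by apply: le_trans (sublinear_geN x sq); rewrite lerN2.
  have leS F x : A F -> inf (S x) <= sval F x.
    by move=> AF; apply: ge_inf => //; exists F.
  have sS : sublinear (fun x => inf (S x)).
    split=> [x y|t x].
      apply: le_infD => // _ _ [q Aq <-] [r Ar <-].
      (* Subadditivity of the infimum uses that [A] is a chain: the smaller of [q] and [r] serves at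
         both points. *)
      have [/asboolP qr|/asboolP rq] := Atot _ _ Aq Ar.
        apply: le_trans (leS r _ Ar) _; apply: le_trans ((svalP r).1.1 _ _) _.
        by rewrite lerD2r.
      apply: le_trans (leS q _ Aq) _; apply: le_trans ((svalP q).1.1 _ _) _.
      by rewrite lerD2l.
    rewrite le_eqVlt => /predU1P[<-|t0].
      rewrite scale0r mul0r -(sublinear0 (svalP q0).1).
      exact: leS.
    rewrite -ler_pdivrMl//; apply: lb_le_inf => // _ [q Aq <-].
    rewrite ler_pdivrMl//; apply: le_trans (leS q _ Aq) _.
    exact: (svalP q).1.2 _ _ (ltW t0).
  have Sp x : inf (S x) <= p x.
    by apply: le_trans (leS q0 _ Aq0) _; exact: (svalP q0).2.
  exists (exist _ (fun x => inf (S x)) (conj sS Sp)) => q Aq.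
  by apply/asboolP => x; exact: leS.
exists q; split=> // r sr rq.
have rp x : r x <= p x by apply: le_trans (rq x) (qp x).
have /(_ _)/(congr1 sval) := qmin (exist _ r (conj sr rp)).
by apply; apply/asboolP.
Qed.

(** Minimising below the tilt of [p] along [w], instead of below [p], forces h(-w) <= -p(w);
    linearity turns this into contact at [w]. *)
Theorem hahn_banach p w : sublinear p ->
  exists h, [/\ linear h, forall x, h x <= p x & h w = p w].
Proof.
move=> sp.
have [h [sh hp hmin]] := minimal_sublinear_exists (sublinear_tiltP w sp).
have lh := minimal_sublinear_linear sh hmin.
have lehp x : h x <= p x.
  exact: le_trans (hp x) (sublinear_tilt_le_self w sp x).
exists h; split=> //; apply/eqP; rewrite eq_le lehp/= -lerN2.
have <- : h (- w) = - h w.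
  by rewrite -(scaleN1r w) -[- h w]mulN1r -[X in h X]addr0 lh sublinear0 ?addr0.
exact: le_trans (hp _) (sublinear_tiltN w sp).
Qed.

End hahn_banach.

(** * Duals and Riesz representation *)

Section dual_space_extra.
Context {R : realType} {V : normedModType R}.

Lemma dual_norm_ge (F : dual_space V) (x : V) : `|F x| <= `|F| * `|x|.
Proof. exact: (le_opnorm x (@dual_continuous _ _ F)). Qed.

Lemma dual_ge (F : dual_space V) (x : V) : F x <= `|F| * `|x|.
Proof. exact: le_trans (ler_norm _) (dual_norm_ge F x). Qed.

(** A one-sided bound suffices, since its value at [- x] gives the other side. *)
Lemma dual_space_exists (h : V -> R) (K : R) : linear h ->
  (forall x, h x <= K * `|x|) -> exists F : dual_space V, forall x, F x = h x.
Proof.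
move=> lh hK.
pose H : {linear V -> R^o} := HB.pack h (GRing.isLinear.Build R V R^o _ h lh).
have ch : continuous H.
  apply: bounded_linear_continuous; apply/linear_boundedP.
  near=> r => x; apply: le_trans (_ : K * `|x| <= _).
    have hN : h (- x) = - h x by exact: (raddfN H).
    rewrite ler_norml hK andbT lerNl -hN -[`|x|]normrN.
    exact: hK.
  by rewrite ler_wpM2r//; near: r; apply: nbhs_pinfty_ge; rewrite num_real.
have hd : h \in dual_pred by rewrite inE; split.
by exists (DualSpace hd).
Unshelve. all: by end_near. Qed.

End dual_space_extra.

Section hilbert.
Context {R : realType} {X : hilbertType R}.
Implicit Types x y : X.

Lemma innerC x y : inner x y = inner y x.
Proof. by rewrite hermC /= expr0 mul1r. Qed.

Lemma innerZl (t : R) x y : inner (t *: x) y = t * inner x y.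
Proof. by rewrite linearZl_LR. Qed.

Lemma innerZr (t : R) x y : inner x (t *: y) = t * inner x y.
Proof. by rewrite innerC innerZl innerC. Qed.

Lemma normD_sqr x y :
  `|x + y| ^+ 2 = `|x| ^+ 2 + 2 * inner x y + `|y| ^+ 2.
Proof.
rewrite -!innerE linearDl/= !linearDr/= (innerC y x); ring.
Qed.

Lemma normB_sqr x y :
  `|x - y| ^+ 2 = `|x| ^+ 2 - 2 * inner x y + `|y| ^+ 2.
Proof.
by rewrite normD_sqr -scaleN1r innerZr normrZ normrN1 !mul1r mulN1r mulrN.
Qed.

Lemma inner_le x y : inner x y <= `|x| * `|y|.
Proof.
have [->|y0] := eqVneq y 0; first by rewrite linear0r normr0 mulr0.
have [->|x0] := eqVneq x 0; first by rewrite linear0l normr0 mul0r.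
have xy0 : 0 < `|x| * `|y| by rewrite mulr_gt0// normr_gt0.
(* The square expands to 2 |x| |y| (|x| |y| - <x, y>), and the first factors are positive. *)
have := sqr_ge0 `|(`|y| *: x) + (- `|x| *: y)|.
rewrite normD_sqr innerZl innerZr !normrZ normrN !normr_id => H.
rewrite -subr_ge0 -(pmulr_rge0 _ xy0) -(pmulr_rge0 _ (ltr0Sn R 1)).
by apply: le_trans H _; rewrite le_eqVlt; apply/orP; left; apply/eqP; ring.
Qed.

(* The representative minimises |x|^2 - 2 F x; the parallelogram law makes the
   filter of almost minimisers Cauchy. *)
Lemma riesz (F : dual_space X) : exists z, forall x, inner z x = F x.
Proof.
pose J x := `|x| ^+ 2 - 2 * F x.
pose m := inf (range J).
have J0 : range J !=set0 by exists (J 0), 0.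
have lbJ : has_lbound (range J).
  exists (- `|F| ^+ 2) => _ [x _ <-]; rewrite /J.
  have := dual_ge F x; have := sqr_ge0 (`|F| - `|x|); nra.
have mJ x : m <= J x by apply: ge_inf => //; exists x.
(* Parallelogram law: |x - y|^2 = 2 J(x) + 2 J(y) - 4 J((x + y) / 2), and the last value of [J] is
   at least m. *)
have par x y : `|x - y| ^+ 2 <= 2 * (J x - m) + 2 * (J y - m).
  have := mJ (2^-1 *: (x + y)); rewrite /J normB_sqr normrZ.
  have -> : F (2^-1 *: (x + y)) = 2^-1 * (F x + F y) by rewrite linearZ/= linearD.
  rewrite ger0_norm ?invr_ge0// exprMn normD_sqr.
  lra.
pose G := filter_from [set e : R | 0 < e] (fun e => [set x | J x < m + e]).
have GF : ProperFilter G.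
  apply: filter_from_proper; last first.
    move=> e /= e0; have [_ [x _ <-] xe] := inf_adherent e0 (conj J0 lbJ).
    by exists x.
  apply: filter_from_filter; first by exists 1 => /=.
  move=> e d /= e0 d0; exists (Num.min e d); first by rewrite /= lt_min e0 d0.
  by move=> x /=; rewrite -ltrBlDl lt_min !ltrBlDl => /andP.
have Gc : cauchy G.
  apply: cauchy_exP => e e0.
  have d0 : 0 < e ^+ 2 / 4 by rewrite divr_gt0// exprn_gt0.
  have [_ [x _ <-] xe] := inf_adherent d0 (conj J0 lbJ).
  exists x; exists (e ^+ 2 / 4) => // y /= ye.
  rewrite -ball_normE /ball_/= -(ltr_pXn2r (isT : (0 < 2)%N)) ?nnegrE ?(ltW e0)//.
  apply: le_lt_trans (par _ _) _; rewrite -/m in xe; lra.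
have /cauchy_cvgP/cvg_ex[z Gz] := Gc.
have Jc : J x @[x --> z] --> J z.
  rewrite /J; under eq_fun do rewrite expr2; rewrite expr2; apply: cvgB.
    by apply: cvgM; apply: cvg_norm.
  by apply: cvgM; [exact: cvg_cst|exact: dual_continuous].
have Jz : J z <= m.
  apply/ler_addgt0Pr => e e0.
  have GJ : J x @[x --> G] --> J z by apply: cvg_trans Jc; apply: cvg_app.
  have e2 : 0 < e / 2 by rewrite divr_gt0.
  have G1 : G [set x | J x < m + e / 2] by exists (e / 2).
  have G2 : \forall x \near G, `|J z - J x| < e / 2.
    by move/cvgrPdist_lt : GJ => /(_ _ e2).
  have [x [/= H1]] := filter_ex (filterI G1 G2).
  rewrite ltr_norml => /andP[_ H2]; lra.
have zmin x t : 0 <= 2 * t * (inner z x - F x) + t ^+ 2 * `|x| ^+ 2.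
  have := le_trans Jz (mJ (z + t *: x)); rewrite /J normD_sqr.
  have -> : F (z + t *: x) = F z + t * F x by rewrite linearD linearZ.
  rewrite innerZr normrZ exprMn real_normK ?num_real//.
  lra.
exists z => x; apply/eqP; rewrite -subr_eq0; apply/eqP.
set a := inner z x - F x in zmin *; set b := `|x| ^+ 2 in zmin *.
have b0 : 0 <= b by rewrite sqr_ge0.
(* The parabola 2 t a + t^2 b is least at t = -a / b; the denominator 1 + b avoids b = 0 and still
   gives a negative value unless a = 0. *)
have := zmin x (- a / (1 + b)); rewrite -/a -/b => H.
have b1 : 0 < 1 + b by lra.
have : 0 <= (2 * (- a / (1 + b)) * a + (- a / (1 + b)) ^+ 2 * b) * (1 + b) ^+ 2.
  by rewrite mulr_ge0// sqr_ge0.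
have -> : (2 * (- a / (1 + b)) * a + (- a / (1 + b)) ^+ 2 * b) * (1 + b) ^+ 2 =
  - (a ^+ 2 * (2 + b)) by field; rewrite gt_eqF.
rewrite oppr_ge0 pmulr_lle0; last by lra.
by move=> a2; apply/eqP; rewrite -sqrf_eq0 eq_le a2 sqr_ge0.
Qed.

End hilbert.

(** * Clarke derivatives *)

Section limf_esup_near.
Context {T : choiceType} {X : filteredType T} {R : realType}.
Context (f : X -> \bar R) (F : set_system X) {FF : Filter F}.

Lemma limf_esup_lt_near (b : \bar R) :
  (limf_esup f F < b)%E -> \forall x \near F, (f x < b)%E.
Proof.
move=> /ereal_inf_lt[_ [A FA <-] Ab]; apply: filterS FA => x Ax.
by apply: le_lt_trans Ab; apply: ereal_sup_ubound; exists x.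
Qed.

Lemma near_le_limf_esup (b : \bar R) :
  (\forall x \near F, (f x <= b)%E) -> (limf_esup f F <= b)%E.
Proof.
move=> Fb; apply: ge_ereal_inf.
exists (ereal_sup (f @` [set x | (f x <= b)%E])).
  by exists [set x | (f x <= b)%E].
by apply: ge_ereal_sup => _ [x /= xb <-].
Qed.

End limf_esup_near.

Lemma cvg_at_right0Mr (R : realType) (t : R) : 0 < t ->
  (l * t) @[l --> (0 : R)^'+] --> (0 : R)^'+.
Proof.
move=> t0 A /nbhs_ballP[e /= e0 eA]; apply/nbhs_ballP; exists (e / t) => /=.
  by rewrite divr_gt0.
move=> l; rewrite /ball/= sub0r normrN ltr_pdivlMr// => le l0.
by apply: eA; rewrite /ball/= ?mulr_gt0// sub0r normrN normrM (gtr0_norm t0).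
Qed.

Section clarke.
Context {R : realType} {X : normedModType R}.
Variables (h : X -> R) (x : X).

Let G := filter_prod (nbhs x) (0 : R)^'+.
Let q (v : X) (p : X * R) : R := (h (p.1 + p.2 *: v) - h p.1) / p.2.

Let G_proper : ProperFilter G.
Proof. exact: filter_prod_proper. Qed.

Let G_fst : p.1 @[p --> G] --> x.
Proof. exact: cvg_fst. Qed.

Let G_snd : p.2 @[p --> G] --> (0 : R)^'+.
Proof. exact: cvg_snd. Qed.

Let cvg_shift (v : X) : (p.1 + p.2 *: v) @[p --> G] --> x.
Proof.
rewrite -[in X in _ --> X](addr0 x) -(scale0r v); apply: cvgD; first exact: G_fst.
apply: cvgZr_tmp.
by apply: cvg_trans G_snd _; exact: cvg_within.
Qed.

Let G_gt0 : \forall p \near G, 0 < p.2.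
Proof. exact: (G_snd (nbhs_right_gt 0)). Qed.

Hypothesis hL : locally_lipschitz h.

(** [K] is a Lipschitz constant of [h] near [x], common to all directions; only the neighbourhood
    depends on [v]. *)
Let clarke_near_bound : exists2 K, 0 <= K &
  forall v, \forall p \near G, `|q v p| <= K * `|v|.
Proof.
have [A Ax /pinfty_ex_gt0[K K0 KA]] := hL x.
exists K => [|v]; first exact: ltW.
near=> p.
have p0 : 0 < p.2 by near: p; exact: G_gt0.
rewrite /q normrM normfV (gtr0_norm p0) ler_pdivrMr//.
have := KA (p.1 + p.2 *: v, p.1); rewrite /= addrAC subrr add0r normrZ (gtr0_norm p0).
rewrite mulrA (mulrAC K); apply; split.
  by near: p; apply: cvg_shift.
by near: p; apply: cvg_fst.
Unshelve. all: by end_near. Qed.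

(** It serves twice: the derivative is finite, so [fine] loses nothing, and any linear functional
    below it is continuous. *)
Lemma clarke_deriv_bound : exists2 K, 0 <= K & forall v,
  ((- (K * `|v|))%:E <= clarke_deriv h x v <= (K * `|v|)%:E)%E.
Proof.
have [K K0 Kq] := clarke_near_bound; exists K => // v; apply/andP; split.
  rewrite leNgt; apply/negP => /limf_esup_lt_near vK.
  have [p [/=]] := @filter_ex _ G _ _ (filterI (Kq v) vK).
  by rewrite lte_fin ler_norml => /andP[+ _] => /le_lt_trans/[apply]; rewrite ltxx.
apply: near_le_limf_esup; apply: filterS (Kq v) => p.
by rewrite lee_fin; apply: le_trans; exact: ler_norm.
Qed.

Lemma clarke_deriv_fin v : clarke_deriv h x v \is a fin_num.
Proof.
have [K _ /(_ v)/andP[Kl Ku]] := clarke_deriv_bound.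
by rewrite fin_numElt (lt_le_trans _ Kl) ?ltNyr// (le_lt_trans Ku) ?ltry.
Qed.

Let clarke_near v e : 0 < e ->
  \forall p \near G, q v p < fine (clarke_deriv h x v) + e.
Proof.
move=> e0; have : (clarke_deriv h x v < (fine (clarke_deriv h x v) + e)%:E)%E.
  by rewrite EFinD fineK ?clarke_deriv_fin// lteDl// ?lte_fin ?clarke_deriv_fin.
by move=> /limf_esup_lt_near; apply: filterS => p; rewrite lte_fin.
Qed.

Let clarke_le v b : (forall e, 0 < e -> \forall p \near G, q v p <= b + e) ->
  fine (clarke_deriv h x v) <= b.
Proof.
move=> vb; apply/ler_addgt0Pr => e /vb qb.
rewrite -lee_fin fineK ?clarke_deriv_fin//.
by apply: near_le_limf_esup; apply: filterS qb => p; rewrite lee_fin.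
Qed.

Lemma clarke_deriv_sublinear : sublinear (fun v => fine (clarke_deriv h x v)).
Proof.
split=> [v w|t v].
  apply: clarke_le => e e0; have e2 : 0 < e / 2 by rewrite divr_gt0.
  (* The increment along v + w is split at y + l v. This point may serve as a new base point because
     the limsup also runs over y. *)
  have Gshift : (p.1 + p.2 *: v, p.2) @[p --> G] --> G.
    exact: (cvg_pair (@cvg_shift v) G_snd).
  have /Gshift qw := clarke_near w e2.
  apply: filterS2 (clarke_near v e2) qw => p.
  rewrite /q/= => vp wp.
  have -> : (h (p.1 + p.2 *: (v + w)) - h p.1) / p.2 =
      (h (p.1 + p.2 *: v + p.2 *: w) - h (p.1 + p.2 *: v)) / p.2 +
      (h (p.1 + p.2 *: v) - h p.1) / p.2.
    by rewrite -mulrDl addrA subrK scalerDr addrA.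
  lra.
rewrite le_eqVlt => /predU1P[<-|t0].
  rewrite scale0r mul0r; apply: clarke_le => e e0; apply: (filterS _ filterT) => p _ /=.
  by rewrite /q scaler0 addr0 subrr mul0r add0r ltW.
apply: clarke_le => e e0; have et : 0 < e / t by rewrite divr_gt0.
have Gscale : (p.1, p.2 * t) @[p --> G] --> G.
  exact: (cvg_pair G_fst (cvg_comp _ _ G_snd (cvg_at_right0Mr t0))).
have /Gscale qt := clarke_near v et; apply: (@filterS _ G _ _ _ _ qt) => p /=.
rewrite /q/= scalerA -(ltr_pM2l t0) mulrDr (mulrCA t e) divff ?gt_eqF// mulr1 => /ltW.
by rewrite invfM mulrCA (mulrCA t) divff ?gt_eqF// mulr1.
Qed.

End clarke.

Section clarke_hilbert.
Context {R : realType} {X : hilbertType R}.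
Variables (h : X -> R) (x : X).
Hypothesis hL : locally_lipschitz h.

(** A linear functional below the sublinear derivative and touching it at [v] is continuous, and its
    Riesz representative is by definition a subgradient. *)
Lemma clarke_subgrad_attained v : exists2 z, clarke_subgrad h x z &
  clarke_deriv h x v = (inner z v)%:E.
Proof.
have [g [lg gp gv]] := hahn_banach v (clarke_deriv_sublinear x hL).
have [K _ hK] := clarke_deriv_bound x hL.
have [|F Fg] := @dual_space_exists _ _ g K lg.
  move=> w; apply: le_trans (gp w) _.
  by rewrite -lee_fin fineK ?clarke_deriv_fin//; have /andP[] := hK w.
have [z zF] := riesz F; exists z => [w|].
  by rewrite zF Fg -[leRHS]fineK ?clarke_deriv_fin// lee_fin.
by rewrite zF Fg gv fineK// clarke_deriv_fin.
Qed.

Lemma clarke_deriv_le_set_norm (a : R) v :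
  (set_norm (clarke_subgrad h x) <= a%:E)%E ->
  (clarke_deriv h x v <= (a * `|v|)%:E)%E.
Proof.
move=> ha; have [z hz ->] := clarke_subgrad_attained v.
rewrite lee_fin; apply: le_trans (inner_le _ _) _; apply: ler_wpM2r => //.
by rewrite -lee_fin; apply: le_trans ha; apply: ereal_sup_ubound; exists z.
Qed.

End clarke_hilbert.

(** * Weak sequential compactness *)

Lemma fmap_ultra (T Y : Type) (f : T -> Y) (F : set_system T) :
  UltraFilter F -> UltraFilter (f @ F).
Proof.
move=> FU; split => [|G GF FG]; first exact: fmap_proper_filter.
rewrite eqEsubset; split=> // A GA.
have [//|FnA] := in_ultra_setVsetC (f @^-1` A) FU.
have /FG GnA : (f @ F) (~` A) by [].
by have [x []] := filter_ex (filterI GA GnA).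
Qed.

Lemma compact_ultra_cvg (T : Type) (Y : topologicalType) (f : T -> Y)
    (F : set_system T) (A : set Y) : UltraFilter F -> compact A ->
  (forall t, A (f t)) -> exists l : Y, f @ F --> l.
Proof.
rewrite compact_ultra => FU Aco fA.
have [|l [_ fl]] := Aco (f @ F) (fmap_ultra f FU); last by exists l.
suff : F (f @^-1` A) by [].
by apply: (filterS _ (@filterT _ F _)) => t _; exact: fA.
Qed.

(** If the preimage of a neighbourhood were not in [F], then [F] restricted to its complement would
    be proper, and an ultrafilter refining it would contradict the hypothesis. *)
Lemma ultra_cvg (T : Type) (Y : topologicalType) (f : T -> Y)
    (F : set_system T) (l : Y) : Filter F ->
  (forall G, UltraFilter G -> F `<=` G -> f @ G --> l) -> f @ F --> l.
Proof.
move=> FF Gl A Al; apply: contrapT => nFA.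
have WP : ProperFilter (within (~` (f @^-1` A)) F).
  split; last exact: within_filter.
  by rewrite /within/= => FA; apply: nFA; apply: filterS FA => t /contrapT.
have [G [GU FG]] := ultraFilterLemma WP.
have GA : G (f @^-1` A) by apply: (Gl G GU _ A Al) => B FB; apply: FG; apply: filterS FB => t Bt _.
have GnA : G (~` (f @^-1` A)) by apply: FG; apply: (filterS _ (@filterT _ F _)) => t _.
by have [t []] := filter_ex (filterI GA GnA).
Qed.

(** * Countable separation on the closed span of a sequence *)

Section rational_span.
Context {R : realType} {V : normedModType R}.
Variable u : nat -> V.
Implicit Types p q : {poly rat}.

(** Rational polynomials encode finite coefficient lists: they form a countable type with addition
    and rational scaling, and the monomial of degree n stands for [u n]. *)
Definition rat_comb p : V := \sum_(i < size p) (ratr p`_i : R) *: u i.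

Lemma rat_comb_widen n p : (size p <= n)%N ->
  rat_comb p = \sum_(i < n) (ratr p`_i : R) *: u i.
Proof.
move=> pn; rewrite /rat_comb (big_ord_widen n (fun i => ratr p`_i *: u i) pn).
rewrite big_mkcond; apply: eq_bigr => i _; case: ltnP => // pi.
by rewrite nth_default// rmorph0 scale0r.
Qed.

Lemma rat_combD p q : rat_comb (p + q) = rat_comb p + rat_comb q.
Proof.
pose n := maxn (size p) (size q).
rewrite (@rat_comb_widen n)//; last exact: size_polyD.
rewrite (@rat_comb_widen n p) ?leq_maxl// (@rat_comb_widen n q) ?leq_maxr//.
by rewrite -big_split; apply: eq_bigr => i _; rewrite coefD rmorphD scalerDl.
Qed.

Lemma rat_combZ (r : rat) p : rat_comb (r *: p) = (ratr r : R) *: rat_comb p.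
Proof.
rewrite (@rat_comb_widen (size p)) ?size_scale_leq// scaler_sumr.
by apply: eq_bigr => i _; rewrite coefZ rmorphM scalerA.
Qed.

Lemma rat_combXn n : rat_comb 'X^n = u n.
Proof.
rewrite /rat_comb size_polyXn big_ord_recr/= coefXn eqxx rmorph1 scale1r.
rewrite big1 ?add0r// => i _.
by rewrite coefXn ltn_eqF// rmorph0 scale0r.
Qed.

Definition dist_span (x : V) : R := inf [set `|x - rat_comb p| | p in setT].

Let dist_lb x : has_lbound [set `|x - rat_comb p| | p in setT].
Proof. by exists 0 => _ [p _ <-]. Qed.

Let dist_neq0 x : [set `|x - rat_comb p| | p in setT] !=set0.
Proof. by exists `|x - rat_comb 0|, 0. Qed.

Lemma dist_span_le x p : dist_span x <= `|x - rat_comb p|.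
Proof. by apply: ge_inf => //; exists p. Qed.

Lemma dist_span_le_norm x : dist_span x <= `|x|.
Proof.
by have := dist_span_le x 0; rewrite /rat_comb size_poly0 big_ord0 subr0.
Qed.

Lemma dist_span_sublinear : sublinear dist_span.
Proof.
split=> [x y|t x].
  apply: le_infD => // _ _ [p _ <-] [q _ <-].
  apply: le_trans (dist_span_le _ (p + q)) _.
  by rewrite rat_combD opprD addrACA ler_normD.
rewrite le_eqVlt => /predU1P[<-|t0].
  by rewrite scale0r mul0r; have := dist_span_le_norm 0; rewrite normr0.
rewrite -ler_pdivrMl//; apply: lb_le_inf => // _ [p _ <-].
rewrite ler_pdivrMl//; apply/ler_addgt0Pr => e e0.
(* Only rational scalars act on the combinations, so [t] is replaced by a rational [r] slightly
   above it; the error (r - t) |rat_comb p| is then at most e. *)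
have d0 : 0 < e / (1 + `|rat_comb p|) by rewrite divr_gt0// ltr_pwDl.
have [r] : exists r : rat, ratr r \in `]t, t + e / (1 + `|rat_comb p|)[.
  by apply: rat_in_itvoo; rewrite ltrDl.
rewrite in_itv/= => /andP[tr rt].
apply: le_trans (dist_span_le _ (r *: p)) _; rewrite rat_combZ.
have -> : t *: x - (ratr r : R) *: rat_comb p =
    t *: (x - rat_comb p) + (t - ratr r) *: rat_comb p.
  by rewrite scalerBr scalerBl addrA subrK.
apply: le_trans (ler_normD _ _) _; rewrite !normrZ (gtr0_norm t0) lerD2l.
rewrite distrC gtr0_norm ?subr_gt0//.
have n0 := normr_ge0 (rat_comb p).
have -> : e = e / (1 + `|rat_comb p|) * (1 + `|rat_comb p|).
  by rewrite divfK// gt_eqF// ltr_pwDl.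
apply: ler_pM => //; [by rewrite subr_ge0 ltW|by rewrite lerBlDl ltW|lra].
Qed.

(** Distance 0 places [w] in the closed span of [u]; separation is asked there only. *)
Definition norming (g : nat -> dual_space V) :=
  forall w, (forall i, g i w = 0) -> dist_span w = 0 -> w = 0.

Lemma dual_of_sublinear (p : V -> R) w : sublinear p ->
  (forall x, p x <= `|x|) ->
  exists g : dual_space V, (forall x, g x <= p x) /\ g w = p w.
Proof.
move=> sp pn; have [h [lh hp hw]] := hahn_banach w sp.
have [|g gh] := @dual_space_exists _ _ h 1 lh.
  by move=> x; rewrite mul1r; exact: le_trans (hp x) (pn x).
by exists g; rewrite gh; split=> // x; rewrite gh.
Qed.

(** Each rational combination c gets a functional g below the norm with g(c) = |c|. If g(w) = 0,
    then |c| = g(c - w) <= |w - c|, so |w| <= 2 |w - c|; the infimum over c gives |w| / 2 <=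
    [dist_span w]. *)
Lemma norming_exists : exists g, norming g.
Proof.
have sn : sublinear (fun x : V => `|x|).
  by split=> [|t x t0]; [exact: ler_normD|rewrite normrZ ger0_norm].
have /choice[g gP] p : exists g : dual_space V,
    (forall x, g x <= `|x|) /\ g (rat_comb p) = `|rat_comb p|.
  exact: (dual_of_sublinear (rat_comb p) sn).
exists (fun i => if unpickle i is Some p then g p else 0) => w gw w0.
have gpw p : g p w = 0 by have := gw (pickle p); rewrite pickleK.
apply/eqP; rewrite -normr_le0 -(pmulr_rle0 _ (_ : 0 < 2^-1)) ?invr_gt0//.
rewrite -w0; apply: lb_le_inf => // _ [p _ <-].
have [gn gp] := gP p.
have : `|rat_comb p| <= `|w - rat_comb p|.
  rewrite distrC -gp -[leLHS]subr0 -(gpw p) -[X in X <= _]linearB.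
  exact: gn.
have := ler_normD (w - rat_comb p) (rat_comb p); rewrite subrK; lra.
Qed.

(** Hahn-Banach with the distance itself as majorant: the functional vanishes on every [u n], since
    both [u n] and [- u n] have distance 0, and it attains the distance at [w]. *)
Lemma dist_span_eq0 w :
  (forall g : dual_space V, (forall n, g (u n) = 0) -> g w = 0) ->
  dist_span w = 0.
Proof.
move=> gw.
have [g [gd gwd]] := dual_of_sublinear w dist_span_sublinear dist_span_le_norm.
rewrite -gwd; apply: gw => n.
have du0 : dist_span (u n) <= 0.
  by have := dist_span_le (u n) 'X^n; rewrite rat_combXn subrr normr0.
have dNu0 : dist_span (- u n) <= 0.
  have := dist_span_le (- u n) ((- 1) *: 'X^n).
  by rewrite rat_combZ rat_combXn rmorphN1 scaleN1r subrr normr0.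
apply/eqP; rewrite eq_le (le_trans (gd _) du0)/= -oppr_le0 -linearN.
exact: le_trans (gd _) dNu0.
Qed.

End rational_span.

Section weak_compactness.
Context {R : realType} {V : normedModType R}.
Hypothesis V_reflexive : reflexive_space V.

(** Compactness of intervals gives a limit for each functional g. The limits are linear in g and at
    most K |g|, so they form an element of the bidual, which reflexivity represents by a vector. *)
Lemma ultra_weak_limit (T : Type) (F : set_system T) (w : T -> V) (K : R) :
  UltraFilter F -> (forall t, `|w t| <= K) ->
  exists v, forall g : dual_space V, g (w t) @[t --> F] --> g v.
Proof.
move=> FU wK.
have gcvg (g : dual_space V) : exists l : R, g (w t) @[t --> F] --> l.
  apply: (compact_ultra_cvg FU (@segment_compact R (- (`|g| * K)) (`|g| * K))).
  move=> t /=; rewrite in_itv/= -ler_norml.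
  by apply: le_trans (dual_norm_ge g _) _; rewrite ler_wpM2l.
have [Phi PhiP] := choice gcvg.
have Phi_lin : linear Phi.
  move=> a g h; apply: (cvg_unique _ (PhiP _)) => //.
  suff : (a * g (w t) + h (w t)) @[t --> F] --> a * Phi g + Phi h by [].
  by apply: cvgD; [apply: cvgM; [exact: cvg_cst|exact: PhiP]|exact: PhiP].
have [|G GPhi] := @dual_space_exists _ _ Phi K Phi_lin.
  move=> g; apply: (cvgr_to_le (PhiP g)); apply: (filterS _ (@filterT _ F _)) => t _.
  by apply: le_trans (dual_ge g _) _; rewrite mulrC ler_wpM2r.
have [v vG] := V_reflexive G; exists v => g.
by rewrite -vG GPhi; exact: PhiP.
Qed.

Lemma increasing_choice (P : nat -> set nat) :
  (forall k N, exists2 n, (N < n)%N & P k n) ->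
  exists2 e : nat -> nat, increasing_seq e & forall k, P k (e k).
Proof.
move=> PN.
have /choice[f fP] (kN : nat * nat) : exists n, (kN.2 < n)%N /\ P kN.1 n.
  by have [n] := PN kN.1 kN.2; exists n.
pose e := fix e k := if k is k'.+1 then f (k, e k') else f (0, 0)%N.
exists e; last by case=> [|k]; [exact: (fP (0, 0)%N).2|exact: (fP (k.+1, e k)).2].
apply/increasing_seqP => k; rewrite ltEnat/=.
by have [] := fP (k.+1, e k).
Qed.

(* Countably many functionals separate the weak limit points of u from each
   other, so it suffices to make these converge along the subsequence. *)
Lemma weakly_cvg_subseq (u : nat -> V) (K : R) : (forall n, `|u n| <= K) ->
  exists2 e : nat -> nat, increasing_seq e &
    exists v, weakly_cvg (u \o e) v.
Proof.
move=> uK; have [g gP] := norming_exists u.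
have [F [FU ooF]] := ultraFilterLemma (eventually_filter : ProperFilter \oo).
have [v vP] := ultra_weak_limit FU uK.
(* Diagonal extraction: the k-th index makes the first k + 1 functionals nearly reach their values
   at [v]. *)
have [k N|e eincr eP] := @increasing_choice (fun k n =>
    forall i : 'I_k.+1, `|g i v - g i (u n)| < k.+1%:R^-1).
  have FN : F [set n | (N < n)%N] by apply: ooF; exact: nbhs_infty_gt.
  have Fk : \forall n \near F, forall i : 'I_k.+1,
      `|g i v - g i (u n)| < k.+1%:R^-1.
    apply: filter_forall => i; have /cvgrPdist_lt := vP (g i).
    by apply; rewrite invr_gt0.
  by have [n [Nn kn]] := filter_ex (filterI FN Fk); exists n.
exists e => //; exists v => h.
have gv i : g i (u (e k)) @[k --> \oo] --> g i v.
  apply/cvgrPdist_lt => _/posnumP[d]; near=> k.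
  have ik : (i < k.+1)%N by near: k; exact: nbhs_infty_ge.
  apply: lt_trans (eP k (Ordinal ik)) _.
  by near: k; exact: near_infty_natSinv_lt.
apply: ultra_cvg => G GU ooG.
have [v' v'P] := ultra_weak_limit GU (fun k => uK (e k)).
(* Both limits agree on every [g i]. A functional that kills all [u n] kills both of them, so their
   difference lies in the closed span, where the [g i] separate points. *)
suff -> : v = v' by exact: v'P.
apply/eqP; rewrite -subr_eq0; apply/eqP; apply: gP => [i|].
  rewrite linearB/=; apply/eqP; rewrite subr_eq0; apply/eqP.
  apply: (cvg_unique _ _ (v'P (g i))) => //.
  by apply: cvg_trans (gv i); exact: cvg_app.
apply: dist_span_eq0 => l lu.
have l0 w (H : set_system nat) (s : nat -> nat) : ProperFilter H ->
    l (u (s k)) @[k --> H] --> l w -> l w = 0.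
  move=> HP lw; apply: (cvg_unique _ lw) => //.
  rewrite (_ : (fun k => l (u (s k))) = cst 0); first exact: cvg_cst.
  by apply/funext => k; exact: lu.
by rewrite linearB/= (l0 _ _ id _ (vP l)) (l0 _ _ e _ (v'P l)) subrr.
Unshelve. all: by end_near. Qed.

End weak_compactness.

Lemma increasing_seq_ge_id (e : nat -> nat) : increasing_seq e ->
  forall n, (n <= e n)%N.
Proof.
move=> /increasing_seqP ei; elim=> [//|n IHn].
exact: leq_ltn_trans IHn (ei n).
Qed.

Lemma bounded_set_bound (R : realType) (V : normedModType R) (S : set V) :
  bounded_set S -> exists2 C, 0 <= C & forall x, S x -> `|x| <= C.
Proof. by move=> /pinfty_ex_gt0[C C0 SC]; exists C => //; exact: ltW. Qed.

Lemma bounded_set_ball (R : realType) (V : normedModType R) (K : R) :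
  bounded_set [set x : V | `|x| <= K].
Proof.
exists K; split; first exact: num_real.
by move=> C KC x /= xK; exact: le_trans xK (ltW KC).
Qed.

(** Along an ultrafilter the images converge strongly to some l by compactness. Weak convergence,
    tested with the inner product against l - M v composed with [M], gives |l - M v|^2 = 0. *)
Lemma compact_operator_weak_cvg (R : realType) (V : normedModType R)
    (X : hilbertType R) (M : {linear V -> X}) (w : nat -> V) (v : V) (K : R) :
  continuous M -> compact_operator M -> (forall n, `|w n| <= K) ->
  weakly_cvg w v -> M (w n) @[n --> \oo] --> M v.
Proof.
move=> cM Mco wK wv.
have [B BM [Bco _]] := Mco _ (@bounded_set_ball R V K).
apply: ultra_cvg => G GU ooG.
have [n|l Ml] := @compact_ultra_cvg _ _ (M \o w) G B GU Bco.
  by apply: BM; exists (w n) => //; exact: wK.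
suff <- : l = M v by exact: Ml.
pose z := l - M v.
have [|F Fz] := @dual_space_exists _ X (inner z) `|z| (fun a x y => linearP _ a x y).
  exact: inner_le.
have [||H HM] := @dual_space_exists _ V (fun x => F (M x)) (`|F| * opnorm M).
- by move=> a x y; rewrite !linearP.
- move=> x; apply: le_trans (dual_ge F _) _; rewrite -mulrA ler_wpM2l//.
  exact: le_opnorm.
have Fl : F (M (w n)) @[n --> G] --> F l.
  exact: (cvg_comp _ _ Ml (@dual_continuous _ _ F l)).
have FMv : F (M (w n)) @[n --> G] --> F (M v).
  rewrite -HM; have := wv H; rewrite (_ : (fun n => H (w n)) = (fun n => F (M (w n)))).
    by move=> Hv; apply: cvg_trans Hv; exact: cvg_app.
  by apply/funext => n; rewrite HM.
have : F l = F (M v) by exact: cvg_unique Fl FMv.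
move/eqP; rewrite -subr_eq0 -linearB/= -/z Fz innerE sqrf_eq0 normr_eq0 subr_eq0.
by move/eqP.
Qed.

Section subsequences.
Context {R : realType} {V : normedModType R}.
Variables (u_ : nat -> V) (u : V) (e : nat -> nat).
Hypotheses (e_incr : increasing_seq e) (u_cvg : weakly_cvg (u_ \o e) u).

(* The hypothesis on phi_ concerns full sequences; u_ \o e is extended by its
   weak limit u off the range of e. *)
Lemma limsup_along_subseq (phi_ : nat -> V -> R) (phi : V -> R) :
  (forall (w_ : nat -> V) (w v : V), weakly_cvg w_ w ->
    (limn_esup (fun n => (phi_ n v - phi_ n (w_ n))%:E)
      <= (phi v - phi w)%:E)%E) ->
  forall v d, 0 < d -> \forall k \near \oo,
    phi_ (e k) v - phi_ (e k) (u_ (e k)) <= phi v - phi u + d.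
Proof.
move=> H v d d0.
pose w n := if `[< range e n >] then u_ n else u.
have wu : weakly_cvg w u.
  move=> g; apply/cvgrPdist_lt => t t0.
  have /cvgrPdist_lt/(_ t t0)[N _ NP] := @u_cvg g.
  exists (e N) => // n /= eNn; rewrite /w; case: asboolP => [[k _ kn]|_].
    rewrite -kn; apply: NP => /=; move: eNn; rewrite -kn -!leEnat.
    by rewrite e_incr.
  by rewrite subrr normr0.
have : (limn_esup (fun n => (phi_ n v - phi_ n (w n))%:E) <
    (phi v - phi u + d)%:E)%E.
  by apply: le_lt_trans (H _ _ _ wu) _; rewrite lte_fin ltrDl.
move=> /limf_esup_lt_near[N _ NP]; exists N => // k /= Nk.
have /= := NP (e k) (leq_trans Nk (increasing_seq_ge_id e_incr k)).
have -> : w (e k) = u_ (e k) by rewrite /w; case: asboolP => // -[]; exists k.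
by rewrite lte_fin => /ltW.
Qed.

End subsequences.

(** * Stability of solutions *)

Section solution.
Context {R : realType} {V : normedModType R} {X : hilbertType R}.
Variables (A : V -> dual_space V) (j : X -> X -> R) (M : {linear V -> X}).
Variables (U : V -> set V) (f : dual_space V) (phi : V -> R) (u : V).
Variables (d1 d2 d3 : R).
Hypothesis j_lip : forall w, locally_lipschitz (j w).
Hypothesis j_growth : forall w v : X,
  (set_norm (clarke_subgrad (j w) v) <= (d1 + d2 * `|w| + d3 * `|v|)%:E)%E.
Hypothesis u_sol : is_solution A j M U f phi u.

Lemma solution_le z : U u z ->
  A u (u - z) <= f (u - z) + fine (clarke_deriv (j (M u)) (M u) (M z - M u)) +
                 (phi z - phi u).
Proof.
move=> /u_sol.2; rewrite -(fineK (clarke_deriv_fin (M u) (@j_lip _) _)).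
rewrite -!EFinD lee_fin.
have -> : (A u - f) (z - u) = A u (z - u) - f (z - u) by [].
by rewrite -(opprB u z) !linearN/=; lra.
Qed.

Lemma clarke_deriv_growth w v z :
  fine (clarke_deriv (j w) v z) <= (d1 + d2 * `|w| + d3 * `|v|) * `|z|.
Proof.
rewrite -lee_fin fineK ?clarke_deriv_fin//.
exact: clarke_deriv_le_set_norm.
Qed.

(** Strong monotonicity between [u] and 0 brings in [A 0]. The quadratic part of the Clarke bound is
    absorbed into [mA]; the terms linear in |u| form the numerator once a factor |u| is cancelled,
    which is why u = 0 is treated apart. *)
Lemma solution_bound mA : continuous M ->
  (forall v1 v2 : V, mA * `|v1 - v2| ^+ 2 <= (A v1 - A v2) (v1 - v2)) ->
  0 <= d1 -> 0 <= d2 -> 0 <= d3 -> U u 0 -> phi 0 = 0 -> (forall v, 0 <= phi v) ->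
  (d2 + d3) * opnorm M ^+ 2 < mA ->
  `|u| <= (`|f| + `|A 0| + d1 * opnorm M) / (mA - (d2 + d3) * opnorm M ^+ 2).
Proof.
move=> cM A_mono d1_ge0 d2_ge0 d3_ge0 u0 phi0 phi_ge0 small.
have u_ge0 := normr_ge0 u.
rewrite ler_pdivlMr ?subr_gt0//.
have [->|un0] := eqVneq u 0.
  by rewrite normr0 mul0r !addr_ge0// mulr_ge0// opnorm_ge0.
have up : 0 < `|u| by rewrite normr_gt0.
rewrite -(ler_pM2r up).
have := A_mono u 0; rewrite subr0.
have -> : (A u - A 0) u = A u u - A 0 u by [].
have := solution_le u0; rewrite subr0 phi0.
have := clarke_deriv_growth (M u) (M u) (M 0 - M u).
have := phi_ge0 u; have := dual_ge f u.
have := dual_ge (A 0) (- u); rewrite linearN normrN /=.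
rewrite linear0 sub0r normrN.
set J := fine _; set m := opnorm M.
have Mu : `|M u| <= m * `|u| by exact: le_opnorm.
have := normr_ge0 (M u); set y := `|M u| in Mu *; set x := `|u| in Mu u_ge0 up *.
move=> y0 hA0 hf hphi hJ hs hm.
have yx : (d1 + d2 * y + d3 * y) * y <= d1 * m * x + (d2 + d3) * m ^+ 2 * x ^+ 2.
  have yy : y ^+ 2 <= (m * x) ^+ 2 by rewrite ler_pXn2r// nnegrE// (le_trans y0).
  have : d1 * y <= d1 * (m * x) by rewrite ler_wpM2l.
  have : (d2 + d3) * y ^+ 2 <= (d2 + d3) * (m * x) ^+ 2 by rewrite ler_wpM2l// addr_ge0.
  by rewrite exprMn; lra.
lra.
Qed.

End solution.

Lemma cvg_distr0 (R : realType) (W : normedModType R) (a b : nat -> W) (l : W) :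
  a @ \oo --> l -> b @ \oo --> l -> `|a k - b k| @[k --> \oo] --> 0.
Proof.
move=> al bl; have : `|a k - b k| @[k --> \oo] --> `|l - l|.
  by apply: cvg_norm; exact: cvgB.
by rewrite subrr normr0.
Qed.

Theorem theorem7 (R : realType) (V : completeNormedModType R) (X : hilbertType R)
  (A : V -> dual_space V) (j : X -> X -> R) (M : {linear V -> X})
  (U : V -> set V) (phi : V -> R) (phi_ : nat -> V -> R)
  (f : dual_space V) (f_ : nat -> dual_space V)
  (mA d1 d2 d3 c : R) (u_ : nat -> V)
  (V_reflexive : reflexive_space V)
  (A_pseudomonotone : pseudomonotone A)
  (mA_gt0 : 0 < mA)
  (A_strongly_monotone : forall v1 v2 : V,
    mA * `|v1 - v2| ^+ 2 <= (A v1 - A v2) (v1 - v2))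
  (j_locally_lipschitz : forall w, locally_lipschitz (j w))
  (d1_ge0 : 0 <= d1) (d2_ge0 : 0 <= d2) (d3_ge0 : 0 <= d3)
  (j_growth : forall w v : X,
    (set_norm (clarke_subgrad (j w) v) <= (d1 + d2 * `|w| + d3 * `|v|)%:E)%E)
  (j_usc : upper_semicontinuous
    (fun p : X * X * X => clarke_deriv (j p.1.1) p.1.2 p.2))
  (M_bounded : bounded_near M (nbhs (0 : V)))
  (M_compact : compact_operator M)
  (U_nonempty : forall v, U v !=set0)
  (U_closed : forall v, closed (U v))
  (U_convex : forall v, convex_set (U v))
  (U_0 : forall v, U v 0)
  (U_mosco : weakly_mosco_continuous U)
  (phi_convex : convex_function setT phi)
  (phi_n_convex : forall n, convex_function setT (phi_ n))
  (phi_lsc : lower_semicontinuous (EFin \o phi))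
  (phi_n_lsc : forall n, lower_semicontinuous (EFin \o phi_ n))
  (phi_ge0 : forall v, 0 <= phi v)
  (phi_n_ge0 : forall n v, 0 <= phi_ n v)
  (phi_0 : phi 0 = 0) (phi_n_0 : forall n, phi_ n 0 = 0)
  (c_gt0 : 0 < c)
  (phi_lipschitz : forall v1 v2 : V, phi v1 - phi v2 <= c * `|v1 - v2|)
  (phi_n_lipschitz : forall n (v1 v2 : V),
    phi_ n v1 - phi_ n v2 <= c * `|v1 - v2|)
  (phi_n_limsup : forall (w_ : nat -> V) (w v : V), weakly_cvg w_ w ->
    (limn_esup (fun n => (phi_ n v - phi_ n (w_ n))%:E)
      <= (phi v - phi w)%:E)%E)
  (f_cvg : f_ @ \oo --> f)
  (smallness : (d2 + d3) * opnorm M ^+ 2 < mA)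
  (u_solution : forall n, is_solution A j M U (f_ n) (phi_ n) (u_ n)) :
  exists2 e : nat -> nat, increasing_seq e &
    exists2 u : V, u_ \o e @ \oo --> u & is_solution A j M U f phi u.
Proof.
have M_continuous : continuous M by exact: bounded_linear_continuous.
have [Kf f_bound] : exists Kf, forall n, `|f_ n| <= Kf.
  have /cvg_seq_bounded/pinfty_ex_gt0[K K0 fK] : cvgn f_ by apply/cvg_ex; exists f.
  by exists K => n; exact: fK.
pose K := (Kf + `|A 0| + d1 * opnorm M) / (mA - (d2 + d3) * opnorm M ^+ 2).
have u_bound n : `|u_ n| <= K.
  have := solution_bound j_locally_lipschitz j_growth (u_solution n) M_continuous
    A_strongly_monotone d1_ge0 d2_ge0 d3_ge0 (U_0 _) (phi_n_0 n) (phi_n_ge0 n)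
    smallness.
  move=> /le_trans; apply; rewrite ler_wpM2r ?invr_ge0 ?subr_ge0 ?(ltW smallness)//.
  by rewrite !lerD2r.
have [e e_incr [u vu]] := weakly_cvg_subseq V_reflexive u_bound.
exists e => //.
pose v k := u_ (e k).
have v_bound k : `|v k| <= K by exact: u_bound.
have e_cvg : e @ \oo --> \oo.
  move=> S [N _ NS]; exists N => // k /= Nk; apply: NS => /=.
  exact: leq_trans Nk (increasing_seq_ge_id e_incr k).
have g_cvg : f_ (e k) @[k --> \oo] --> f by exact: cvg_comp e_cvg f_cvg.
have [Umosco1 Umosco2] := U_mosco v u vu.
have Uu : U u u.
  apply: (Umosco1 v) => [n|]; first exact: (u_solution (e n)).1.
  by exists id.
have Mv_cvg : M (v k) @[k --> \oo] --> M u.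
  by apply: (compact_operator_weak_cvg M_continuous M_compact _ vu) => n; exact: u_bound.
(* This makes A(v_k) applied to a strongly null sequence vanish without any convergence of
   A(v_k). *)
have [CA CA_ge0 A_bound] : exists2 C, 0 <= C & forall k, `|A (v k)| <= C.
  have [C C0 CP] := bounded_set_bound
    (A_pseudomonotone.1 _ (@bounded_set_ball R V K)).
  by exists C => // k; apply: CP; exists (v k) => //; exact: u_bound.
pose eta k := `|f_ (e k) - f|.
have eta0 : eta k @[k --> \oo] --> 0.
  exact: cvg_distr0 g_cvg (cvg_cst f).
have dist0 (w : nat -> V) (x : V) : w @ \oo --> x ->
    `|w k - x| @[k --> \oo] --> 0.
  by move=> wx; exact: cvg_distr0 wx (cvg_cst x).
have M_cvg (w : nat -> V) (x : V) : w @ \oo --> x ->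
    M (w k) @[k --> \oo] --> M x.
  by move=> wx; exact: (cvg_comp _ _ wx (M_continuous x)).
have A_le k x : A (v k) x <= CA * `|x|.
  by apply: le_trans (dual_ge _ _) _; rewrite ler_wpM2r.
have f_le k x : f_ (e k) x <= f x + eta k * `|x|.
  rewrite -lerBlDl; have -> : f_ (e k) x - f x = (f_ (e k) - f) x by [].
  exact: dual_ge.
have v_cvg : v @ \oo --> u.
  have [w Uw wu] := Umosco2 u Uu.
  have w0 := dist0 _ _ wu.
  have Mw0 : `|M (w k) - M (v k)| @[k --> \oo] --> 0.
    exact: cvg_distr0 (M_cvg _ _ wu) Mv_cvg.
  (* The growth coefficient of the Clarke derivative when |M v_k| <= [opnorm M * K]. *)
  pose C0 := d1 + d2 * (opnorm M * K) + d3 * (opnorm M * K).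
  (* All errors made in replacing [w k] by [u] and [f_ (e k)] by [f], plus the Clarke bound. The
     last term, due to strong monotonicity, and the difference of [f] values vanish by weak
     convergence alone. *)
  pose r k := eta k * (K + `|u| + `|w k - u|) + (f (v k) - f u) +
    (`|f| + c + CA) * `|w k - u| + C0 * `|M (w k) - M (v k)| -
    (A u (v k) - A u u).
  have r0 : r k @[k --> \oo] --> 0.
    have -> : (0 : R) = 0 * (K + `|u| + 0) + (f u - f u) +
        (`|f| + c + CA) * 0 + C0 * 0 - (A u u - A u u) by ring.
    apply: cvgB; last by apply: cvgB; [exact: vu|exact: cvg_cst].
    apply: cvgD; last by apply: cvgM; [exact: cvg_cst|exact: Mw0].
    apply: cvgD; last by apply: cvgM; [exact: cvg_cst|exact: w0].
    apply: cvgD; last by apply: cvgB; [exact: vu|exact: cvg_cst].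
    by apply: cvgM => //; apply: cvgD => //; exact: cvg_cst.
  have key k : mA * `|v k - u| ^+ 2 <=
      r k + (phi_ (e k) u - phi_ (e k) (v k)).
    have sol := solution_le j_locally_lipschitz (u_solution (e k)) (Uw k).
    have J_le := clarke_deriv_growth j_locally_lipschitz j_growth
      (M (v k)) (M (v k)) (M (w k) - M (v k)).
    have Mv_le : `|M (v k)| <= opnorm M * K.
      apply: le_trans (le_opnorm _ M_continuous) _.
      by rewrite ler_wpM2l ?opnorm_ge0 ?v_bound.
    have J_le0 : (d1 + d2 * `|M (v k)| + d3 * `|M (v k)|) * `|M (w k) - M (v k)|
        <= C0 * `|M (w k) - M (v k)|.
      by rewrite ler_wpM2r// lerD ?lerD ?ler_wpM2l.
    have vw_le : `|v k - w k| <= K + `|u| + `|w k - u|.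
      rewrite -(subrKA u (v k) (- w k)); apply: le_trans (ler_normD _ _) _.
      rewrite (distrC u); rewrite lerD2r; apply: le_trans (ler_normB _ _) _.
      by rewrite lerD2r.
    have eta_le := ler_wpM2l (normr_ge0 (f_ (e k) - f)) vw_le.
    have := A_strongly_monotone (v k) u.
    have -> : (A (v k) - A u) (v k - u) = A (v k) (v k - u) - A u (v k - u) by [].
    have fvw := f_le k (v k - w k).
    have fw := dual_ge f (u - w k); rewrite distrC in fw.
    have Aw := A_le k (w k - u).
    have phiw := phi_n_lipschitz (e k) (w k) u.
    move: sol fvw fw Aw J_le.
    rewrite /r !linearB /= -/(v k) -/(eta k) => sol fvw fw Aw J_le.
    rewrite -/(eta k) in eta_le.
    lra.
  apply/cvgrPdist_le => d d0.
  (* Half of mA d^2 for [r], half for the difference of [phi_] at [u], whose limsup is at most 0. *)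
  have d'0 : 0 < mA * d ^+ 2 / 2 by rewrite divr_gt0// mulr_gt0// exprn_gt0.
  have phi_le := limsup_along_subseq e_incr vu phi_n_limsup u d'0.
  have r_le : \forall k \near \oo, r k <= mA * d ^+ 2 / 2.
    exact: cvgr_le r0 _ d'0.
  apply: filterS2 phi_le r_le => k phik rk.
  rewrite distrC -(ler_pXn2r (isT : (0 < 2)%N)) ?nnegrE ?(ltW d0)//.
  rewrite -(ler_pM2l mA_gt0); apply: le_trans (key k) _.
  by rewrite /v; lra.
exists u => //; split=> // z Uz.
have [w Uw wz] := Umosco2 z Uz.
have w0 := dist0 _ _ wz; have v0 := dist0 _ _ v_cvg.
pose J := fine (clarke_deriv (j (M u)) (M u) (M z - M u)).
(* The premise of pseudomonotonicity follows from the strong convergence just obtained and the bound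
   on A(v_k). *)
have A_limsup : (limn_esup (fun n => (A (v n) (v n - u))%:E) <= 0)%E.
  apply/lee_addgt0Pr => d d0; rewrite add0e; apply: near_le_limf_esup.
  have Av0 : CA * `|v k - u| @[k --> \oo] --> 0.
    by rewrite -(mulr0 CA); apply: cvgM => //; exact: cvg_cst.
  have Av_le : \forall k \near \oo, CA * `|v k - u| <= d.
    exact: cvgr_le Av0 _ d0.
  apply: filterS Av_le => k Avk.
  by rewrite lee_fin; exact: le_trans (A_le _ _) Avk.
have A_liminf := A_pseudomonotone.2 v u vu A_limsup z.
have A_near d : 0 < d -> \forall k \near \oo, A u (u - z) - d <= A (v k) (v k - z).
  move=> d0.
  have : (limn_esup (\- (fun n => (A (v n) (v n - z))%:E)) < (d - A u (u - z))%:E)%E.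
    move: A_liminf; rewrite /limn_einf leeNr => /le_lt_trans; apply.
    by rewrite -EFinN lte_fin; lra.
  move=> /limf_esup_lt_near; apply: filterS => k.
  by rewrite -EFinN lte_fin; lra.
have J_near d : 0 < d -> \forall k \near \oo,
    fine (clarke_deriv (j (M (v k))) (M (v k)) (M (w k) - M (v k))) <= J + d.
  move=> d0.
  have Jd : (clarke_deriv (j (M u)) (M u) (M z - M u)%R < (J + d)%:E)%E.
    by rewrite -(fineK (clarke_deriv_fin (M u) (@j_locally_lipschitz _) _)) lte_fin ltrDl.
  have [N Nu NP] := j_usc (M u, M u, M z - M u) (J + d) Jd.
  have Mw : M (w k) - M (v k) @[k --> \oo] --> M z - M u.
    exact: cvgB (M_cvg _ _ wz) Mv_cvg.
  have Mp : (M (v k), M (v k), M (w k) - M (v k)) @[k --> \oo] -->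
      (M u, M u, M z - M u).
    exact: cvg_pair (cvg_pair Mv_cvg Mv_cvg) Mw.
  have Np : \forall k \near \oo, N (M (v k), M (v k), M (w k) - M (v k)).
    exact: Mp Nu.
  apply: filterS Np => k /NP /= Jk.
  by rewrite -lee_fin fineK ?clarke_deriv_fin// ltW.
(* Errors of replacing [w k] by [z], [f_ (e k)] by [f] and then f(v_k) by f(u); the Clarke and
   [phi_] terms stay apart, having only one-sided limits. *)
pose s k := (CA + `|f| + c) * `|w k - z| + eta k * `|v k - w k| +
  `|f| * `|v k - u|.
have s0 : s k @[k --> \oo] --> 0.
  have -> : (0 : R) = (CA + `|f| + c) * 0 + 0 * `|u - z| + `|f| * 0 by ring.
  apply: cvgD; last by apply: cvgM => //; exact: cvg_cst.
  apply: cvgD; first by apply: cvgM => //; exact: cvg_cst.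
  by apply: cvgM => //; apply: cvg_norm; exact: cvgB.
have key k : A (v k) (v k - z) <= f (u - z) +
    fine (clarke_deriv (j (M (v k))) (M (v k)) (M (w k) - M (v k))) +
    (phi_ (e k) z - phi_ (e k) (v k)) + s k.
  have sol := solution_le j_locally_lipschitz (u_solution (e k)) (Uw k).
  have fvw := f_le k (v k - w k).
  have fw := dual_ge f (z - w k); rewrite distrC in fw.
  have fv := dual_ge f (v k - u).
  have Aw := A_le k (w k - z).
  have phiw := phi_n_lipschitz (e k) (w k) z.
  move: sol fvw fw fv Aw.
  by rewrite /s !linearB /= -/(v k); lra.
have final : A u (u - z) <= f (u - z) + J + (phi z - phi u).
  (* A quarter of d for each of four one-sided limits: [phi_], [s], the Clarke derivative and
     [A]. *)
  apply/ler_addgt0Pr => d d0; have d4 : 0 < d / 4 by rewrite divr_gt0.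
  have phi_le := limsup_along_subseq e_incr vu phi_n_limsup z d4.
  have s_le : \forall k \near \oo, s k <= d / 4 by exact: cvgr_le s0 _ d4.
  have [k [[[phik sk] Jk] Ak]] := filter_ex
    (filterI (filterI (filterI phi_le s_le) (J_near _ d4)) (A_near _ d4)).
  by have := key k; move: phik sk Jk Ak; rewrite /= /v; lra.
rewrite -(fineK (clarke_deriv_fin (M u) (@j_locally_lipschitz _) _)) -/J.
rewrite -!EFinD lee_fin.
have -> : (A u - f) (z - u) = A u (z - u) - f (z - u) by [].
by move: final; rewrite -(opprB z u) !linearN/=; lra.
Qed.
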